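(* Let $N$ be a natural number whose Bergman expansion has $n+1$ digits $1$ (with $n\ge 0$), and write this expansion, with the radix point removed, as $$10^{s_n}\,10^{s_{n-1}}\cdots 10^{s_1}\,1 .$$ Define $r_0=1$, and $r_1=\frac12 s_1+1$ if $s_1$ is even, $r_1=\frac12(s_1+1)$ if $s_1$ is odd, and for $k\ge 2$ $$r_k=\begin{cases}\left[\frac12 s_k+1\right] r_{k-1} & \text{if } s_k \text{ is even},\\[2pt] \left[\frac12(s_k+1)+1\right] r_{k-1}-r_{k-2} & \text{if } s_k \text{ is odd}.\end{cases}$$ Then the number of natural base phi expansions of $N$ is $\mathrm{Tot}^{\nu}(N)=r_n$.
   Context: Let $\varphi=(1+\sqrt5)/2$. A finite base phi expansion of $N$ is a sequence $(a_i)_{i\in\mathbb Z}$ with $a_i\in\{0,1\}$, only finitely many $a_i$ nonzero, and $N=\sum_i a_i\varphi^i$. The Bergman expansion $\beta(N)$ is the unique finite base phi expansion $(d_i)$ of $N$ in which $d_{i+1}d_i=11$ never occurs; it is written $d_L d_{L-1}\dots d_0\cdot d_{-1}\dots d_R$ with $d_L=d_R=1$ the first and last nonzero digits (so the word obtained by removing the radix point begins and ends with $1$). Here $0^s$ denotes a block of $s$ zeros. A Knott expansion of $N$ is a finite base phi expansion $(a_i)$ of $N$ such that, if $R$ denotes the smallest index with $a_R=1$, then $a_{R+2}a_{R+1}a_R\neq 011$. A natural base phi expansion of $N$ is a Knott expansion of $N$ whose negative part (the digits to the right of the radix point, up to the last nonzero digit) has the same length as the negative part of the Bergman expansion $\beta(N)$;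 i.e. its smallest index with digit $1$ equals that of $\beta(N)$. The number of natural base phi expansions of $N$ is denoted $\mathrm{Tot}^{\nu}(N)$. *)

(* Defs.v *)
From HB Require Import structures.
From mathcomp Require Import all_boot all_order all_algebra.
From mathcomp Require Import finmap.
From mathcomp Require Import boolp classical_sets cardinality fsbigop reals.

Set Implicit Arguments.
Unset Strict Implicit.
Unset Printing Implicit Defensive.

Import Order.TTheory GRing.Theory Num.Theory.
Local Open Scope classical_set_scope.
Local Open Scope ring_scope.

Definition phi (R : realType) : R := (1 + Num.sqrt 5) / 2.

(* A two-sided sequence of digits in {0,1}; [a i] is the digit a_i. *)
Definition digits := int -> bool.

Definition base_phi_expansion (R : realType) (N : nat) (a : digits) : Prop :=
  finite_set [set i | a i] /\
  N%:R = \sum_(i \in [set: int]) (a i)%:R * phi R ^ i.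

Definition lowest_one (a : digits) (m : int) : Prop :=
  a m /\ forall i, i < m -> ~~ a i.

Definition highest_one (a : digits) (m : int) : Prop :=
  a m /\ forall i, m < i -> ~~ a i.

Definition bergman_expansion (R : realType) (N : nat) (d : digits) : Prop :=
  base_phi_expansion R N d /\ forall i, ~~ (d (i + 1) && d i).

Definition knott_expansion (R : realType) (N : nat) (a : digits) : Prop :=
  base_phi_expansion R N a /\
  forall m, lowest_one a m ->
    [:: a (m + 2); a (m + 1); a m] <> [:: false; true; true].

Definition natural_expansion (R : realType) (N : nat) (a : digits) : Prop :=
  knott_expansion R N a /\
  exists d m, [/\ bergman_expansion R N d, lowest_one d m & lowest_one a m].

(* [fset_set] of an infinite set is empty, so a positive value also says that
   there are finitely many natural expansions. *)
Definition Tot_nu (R : realType) (N : nat) : nat :=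
  #|` fset_set [set a | natural_expansion R N a]|.

(* d_hi d_(hi-1) ... d_lo, without the radix point (for lo <= hi). *)
Definition digit_word (d : digits) (hi lo : int) : seq bool :=
  [seq d (hi - i%:Z) | i <- iota 0 `|hi - lo|.+1].

(* 1 0^(s n) 1 0^(s n.-1) ... 1 0^(s 1) 1; only s 1, ..., s n matter. *)
Fixpoint block_word (s : nat -> nat) (n : nat) : seq bool :=
  if n is n'.+1 then true :: nseq (s n) false ++ block_word s n'
  else [:: true].

(* Valued in int because of the subtraction; the halvings are exact. *)
Fixpoint r (s : nat -> nat) (k : nat) : int :=
  match k with
  | 0 => 1
  | k1.+1 =>
    match k1 with
    | 0 => if odd (s 1%N) then ((s 1%N).+1./2)%:Z else ((s 1%N)./2)%:Z + 1
    | k2.+1 =>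
      if odd (s k) then (((s k).+1./2)%:Z + 1) * r s k1 - r s k2
      else (((s k)./2)%:Z + 1) * r s k1
    end
  end.

(* Main.v *)
Require Import Defs.
From mathcomp Require Import all_boot all_order all_algebra.
From mathcomp Require Import finmap zify ring lra.
From mathcomp Require Import boolp classical_sets cardinality fsbigop reals.

(** Why the formula holds.

    Divide [N] by [phi ^ lo], where [lo] is the lowest index of the Bergman
    expansion: expansions supported in [lo, lo + L) become binary words of
    length [L] with a prescribed real value [x].  As [x < phi ^ L], every
    expansion of [N] that starts at [lo] fits in these [L] places, so the
    task is to enumerate the words of length [L] and value [x] ([reps]).

    The enumeration is greedy and uses only two order facts: a remainder that
    is negative has no word, and neither has a remainder [>= phi ^ L.+1] on
    [L] places, because all ones only give [phi ^ L.+1 - phi].  Let [v] be the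
    value of a shorter block word on [m.+1] places, whose words are already
    enumerated, and prepend [1 0^s].  Either the leading 1 is kept, and then
    the zeros are forced and a word for [v] follows; or it is not kept, and
    then the next place must hold a 1 and, since
    [phi ^ (k+2) - phi ^ (k+1) = phi ^ k], what remains is the same problem
    with [s - 2] zeros.  The descent stops at [s = 0], where the leading 1
    has to be kept ([block0]), or at [s = 1], where one can in addition
    replace [1 0 1] by [0 1 1], which uses up the leading 1 of the word for
    [v] and leaves a word for [v] that starts with 0 ([block1], [blockSS]).
    If [c] words represent [v], and [c0] of them start with 0, the new count
    is [(s/2 + 1) c], plus [c0] when [s] is odd ([size_block]).  Since a word
    for [v] that starts with 1 is a word for the next shorter block,
    [c0 = r_(k-1) - r_(k-2)], and this is the recurrence for [r]
    ([reps_block_word]).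

    The same induction shows that all these words end in 1: starting from
    the single word [1], it only adds and exchanges prefixes.  So
    every one of them has the lowest index of the Bergman expansion.  The
    Knott condition follows: a final 011 could be rewritten to 100,
    giving a word of the same value that ends in 0 ([no_trailing011]).
    Conversely the Bergman expansion is unique ([bergman_unique]), so every
    natural expansion starts at [lo]; hence natural expansions and words
    correspond ([natural_reps]). *)

Set Implicit Arguments.
Unset Strict Implicit.
Unset Printing Implicit Defensive.

Import Order.TTheory GRing.Theory Num.Theory.

Local Open Scope ring_scope.

(** * The golden mean and values of words *)

Section GoldenMean.
Context {R : realType}.
Local Notation phi := (phi R).

Lemma phi_gt1 : 1 < phi.
Proof.
have h : 1 < Num.sqrt (5 : R) by rewrite -[X in X < _]sqrtr1 ltr_sqrt; lra.
by rewrite /Defs.phi; lra.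
Qed.

Lemma phi_gt0 : 0 < phi.
Proof. exact: lt_trans ltr01 phi_gt1. Qed.

Lemma phi_sqr : phi * phi = phi + 1.
Proof.
have h : Num.sqrt (5 : R) ^+ 2 = 5 by rewrite sqr_sqrtr //; lra.
rewrite /Defs.phi; move: (Num.sqrt _) h => q h.
have -> : (1 + q) / 2 * ((1 + q) / 2) = (1 + 2 * q + q ^+ 2) / 4 by field.
by rewrite h; field.
Qed.

Lemma phi_lt2 : phi < 2.
Proof. by have := phi_sqr; have := phi_gt1; nra. Qed.

Lemma exp_phi_gt0 n : 0 < phi ^+ n.
Proof. by rewrite exprn_gt0 // phi_gt0. Qed.

Lemma exp_phiSS n : phi ^+ n.+2 = phi ^+ n.+1 + phi ^+ n.
Proof. by rewrite !exprS mulrA phi_sqr mulrDl mul1r. Qed.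

Lemma exp_phiS_lt n : phi ^+ n.+1 < phi ^+ n + phi ^+ n.
Proof. by have := phi_lt2; have := exp_phi_gt0 n; rewrite exprS; nra. Qed.

Lemma phiz_neq0 (i : int) : phi ^ i != 0.
Proof. by apply: expfz_neq0; apply: lt0r_neq0 phi_gt0. Qed.

(** Words are read with the most significant digit first, and the last digit
    has weight 1. *)
Fixpoint val (w : seq bool) : R :=
  if w is b :: w' then b%:R * phi ^+ size w' + val w' else 0.

Lemma val_ge0 w : 0 <= val w.
Proof.
elim: w => //= b w ih; rewrite addr_ge0 // mulr_ge0 // ?ler0n //.
exact/ltW/exp_phi_gt0.
Qed.

Definition no11 : seq bool -> bool := sorted (fun a b => ~~ (a && b)).

(** A leading 1 is followed by a 0, so two digits are removed at a time and
    [phi ^ n.+1 + phi ^ n = phi ^ n.+2] closes the induction. *)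
Lemma val_lt w : no11 w -> val w < phi ^+ size w.
Proof.
have [n] := ubnP (size w); elim: n w => // n ih [|[] [|[] w]] //= hn nw.
- by rewrite mul1r addr0 expr1 expr0 phi_gt1.
- rewrite mul1r mul0r add0r exp_phiSS ltrD2l ih //; first by lia.
  exact: path_sorted nw.
- by rewrite mul0r addr0 expr1 phi_gt0.
- rewrite mul0r add0r exp_phiSS ltr_wpDr //; first exact/ltW/exp_phi_gt0.
  by apply: (ih (true :: w)) => //; lia.
- rewrite !mul0r !add0r exp_phiSS.
  apply: (@lt_trans _ _ (phi ^+ size w)); last by rewrite ltrDr exp_phi_gt0.
  by apply: ih; [lia | exact: path_sorted nw].
Qed.

(** At the first difference one word gains [phi ^ n], which the tail of the
    other word cannot make up by [val_lt]. *)
Lemma no11_val_inj w1 w2 :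
  size w1 = size w2 -> no11 w1 -> no11 w2 -> val w1 = val w2 -> w1 = w2.
Proof.
elim: w1 w2 => [|b1 w1 ih] [|b2 w2] //= [hs] n1 n2.
have {}n1 := path_sorted n1; have {}n2 := path_sorted n2.
have := val_lt n1; have := val_lt n2; have := val_ge0 w1; have := val_ge0 w2.
case: b1 b2 => [] [] /=; rewrite ?mul1r ?mul0r ?add0r hs.
- by move=> _ _ _ _ /addrI /(ih _ hs n1 n2) ->.
- by move=> _ h1 h2 _ hv; move: h2; rewrite -hv gtrDl ltNge h1.
- by move=> h1 _ _ h2 hv; move: h2; rewrite hv gtrDl ltNge h1.
- by move=> _ _ _ _ /(ih _ hs n1 n2) ->.
Qed.

(** * Greedy enumeration of the words with a given value *)

Fixpoint reps (L : nat) (x : R) : seq (seq bool) :=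
  if L is L'.+1 then
    map (cons true) (reps L' (x - phi ^+ L')) ++ map (cons false) (reps L' x)
  else if x == 0 then [:: [::]] else [::].

Lemma repsS L x : reps L.+1 x =
  map (cons true) (reps L (x - phi ^+ L)) ++ map (cons false) (reps L x).
Proof. by []. Qed.

Lemma mem_map_cons b c w (l : seq (seq bool)) :
  (b :: w \in map (cons c) l) = (b == c) && (w \in l).
Proof.
apply/mapP/andP => [[v vl [-> ->]] //|[/eqP -> wl]]; by exists w.
Qed.

Lemma mem_reps L x w : (w \in reps L x) = (size w == L) && (val w == x).
Proof.
elim: L x w => [|L ih] x [|b w] /=.
- by rewrite eq_sym; case: eqP.
- by case: ifP => // _; rewrite inE.
- by rewrite mem_cat; apply/negbTE/negP => /orP [] /mapP [].
- rewrite mem_cat !mem_map_cons !ih eqSS.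
  case: b => /=; rewrite ?mul1r ?mul0r ?add0r ?orbF //.
  by case: eqP => //= <-; rewrite eq_sym subr_eq eq_sym addrC.
Qed.

Lemma reps_uniq L x : uniq (reps L x).
Proof.
elim: L x => [|L ih] x /=; first by case: ifP.
have inj b : injective (cons b : seq bool -> _) by move=> ? ? [].
rewrite cat_uniq !map_inj_uniq // !ih /= andbT.
by apply/hasPn => _ /mapP [w _ ->]; rewrite mem_map_cons.
Qed.

Lemma reps_neg L x : x < 0 -> reps L x = [::].
Proof.
elim: L x => [|L ih] x hx /=; first by rewrite lt_eqF.
by rewrite !ih // subr_lt0 (lt_trans hx) ?exp_phi_gt0.
Qed.

(** The sharp bound on the value of [L] ones is [phi ^ L.+1 - phi]; this
    cruder one is stable under the recursion. *)
Lemma reps_big L x : phi ^+ L.+1 <= x -> reps L x = [::].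
Proof.
elim: L x => [|L ih] x hx /=.
  by rewrite gt_eqF // (lt_le_trans _ hx) ?exp_phi_gt0.
have := exp_phi_gt0 L; move: hx; rewrite exp_phiSS => hx h0.
by rewrite !ih //=; lra.
Qed.

(** A 1 in any of the [k] extra places would exceed [x]. *)
Lemma reps_lead0 L k x : x < phi ^+ L ->
  reps (k + L) x = map (cat (nseq k false)) (reps L x).
Proof.
move=> hx; elim: k => [|k ih] /=; first by rewrite map_id.
rewrite reps_neg ?ih -?map_comp // subr_lt0 (lt_le_trans hx) //.
by rewrite ler_eXn2l ?phi_gt1 // leq_addl.
Qed.

(** * Prepending a block of zeros *)

Section Block.
Context (m : nat) (v : R) (v_ge : phi ^+ m <= v) (v_lt : v < phi ^+ m.+1).

(** The bounds on [v] say that it has the size of a word of length [m.+1]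
    that starts with 1; [block_reps s] then lists the words for [1 0^s]
    followed by such a word. *)
Definition block_reps s := reps (s + m.+1).+1 (phi ^+ (s + m.+1) + v).

(** The words that keep the leading 1: the [s] zeros after it are forced. *)
Definition keep_top s : seq (seq bool) :=
  map (cat (true :: nseq s false)) (reps m.+1 v).

Lemma block_top s : block_reps s =
  keep_top s ++ map (cons false) (reps (s + m.+1) (phi ^+ (s + m.+1) + v)).
Proof. by rewrite /block_reps repsS [_ + v]addrC addrK reps_lead0 // -map_comp. Qed.

(** Without the leading 1, the value [phi ^ m.+1 + v >= phi ^ m.+2] is too
    large for the remaining [m.+1] places. *)
Lemma block0 : block_reps 0 = keep_top 0.
Proof.
by rewrite block_top reps_big ?cats0 // exp_phiSS add0n lerD2l.
Qed.

Let v_ge0 : 0 <= v.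
Proof. exact: le_trans (ltW (exp_phi_gt0 m)) v_ge. Qed.

(** Without the leading 1, the second place holds a 1 and [phi ^ m + v] is
    left for [m.+1] places.  As [phi ^ m + v >= 2 phi ^ m > phi ^ m.+1], the
    third place holds a 1 too, which leaves [v] itself for [m] places. *)
Lemma block1 : block_reps 1 = keep_top 1 ++ map (cat [:: false; true; true]) (reps m v).
Proof.
rewrite block_top add1n !repsS exp_phiSS.
have -> : phi ^+ m.+1 + phi ^+ m + v - phi ^+ m.+1 = phi ^+ m + v by ring.
have -> : phi ^+ m + v - phi ^+ m = v by ring.
rewrite (@reps_big m (phi ^+ m + v)); last first.
  by rewrite (le_trans (ltW (exp_phiS_lt m))) // lerD2l.
rewrite (@reps_big m (_ - _)); last first.
  by rewrite [_ + v]addrC addrA addrK lerDr.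
rewrite (@reps_big m (_ + v)); last first.
  by rewrite -addrA lerDl addr_ge0 // ltW // exp_phi_gt0.
by rewrite /= !cats0 -!map_comp.
Qed.

(** Without the leading 1, the second place holds a 1, and
    [phi ^ n.+2 - phi ^ n.+1 = phi ^ n] is the leading 1 of a block with two
    zeros fewer. *)
Lemma blockSS s : block_reps s.+2 = keep_top s.+2 ++ map (cat [:: false; true]) (block_reps s).
Proof.
rewrite block_top !addSn repsS.
rewrite (_ : _ - _ = phi ^+ (s + m.+1) + v); last by rewrite exp_phiSS; ring.
rewrite [X in _ ++ map _ (_ ++ map _ X)]reps_big; last by rewrite lerDl.
by rewrite cats0 -!map_comp.
Qed.
End Block.

(** The default [false] makes [last false w] say that [w] is nonempty and
    ends in 1, which is what survives both adding and removing prefixes. *)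
Lemma last_prefix (u w : seq bool) : last false w -> last false (u ++ w).
Proof. by rewrite last_cat; case: w. Qed.

Lemma all_last_prefix (u : seq bool) (l : seq (seq bool)) :
  all (last false) l -> all (last false) (map (cat u) l).
Proof.
by move=> h; rewrite all_map; apply: sub_all h => w; exact: last_prefix.
Qed.

Section BlockCount.
Context (m : nat) (v : R) (v_ge : phi ^+ m <= v) (v_lt : v < phi ^+ m.+1).

Lemma size_block s : size (block_reps m v s) =
  (s./2.+1 * size (reps m.+1 v) + odd s * size (reps m v))%N.
Proof.
have [k] := ubnP s; elim: k s => // k ih [|[|s]] hs.
- by rewrite block0 // size_map /=; lia.
- by rewrite block1 // size_cat !size_map /=; lia.
- rewrite blockSS // size_cat !size_map ih; last by lia.
  by rewrite /= negbK; lia.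
Qed.

Lemma last_block s : all (last false) (reps m.+1 v) ->
  all (last false) (block_reps m v s).
Proof.
move=> h; have h' : all (last false) (reps m v).
  by move: h; rewrite repsS all_cat => /andP [_]; rewrite all_map.
have hk t : all (last false) (keep_top m v t) by exact: all_last_prefix.
have [k] := ubnP s; elim: k s => // k ih [|[|s]] hs.
- by rewrite block0.
- by rewrite block1 // all_cat hk all_last_prefix.
- by rewrite blockSS // all_cat hk all_last_prefix // ih //; lia.
Qed.
End BlockCount.

Lemma val_nseq0 k w : val (nseq k false ++ w) = val w.
Proof. by elim: k => //= k ->; rewrite mul0r add0r. Qed.

Lemma no11_nseq0 k w : no11 (nseq k false ++ w) -> no11 w.
Proof. by elim: k => //= k ih /path_sorted. Qed.

(** * Counting the words with the value of a block word *)

Section BlockWord.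
Context (s : nat -> nat).
Local Notation W := (block_word s).

Lemma block_wordS_size n : size (W n.+1) = (s n.+1 + size (W n)).+1.
Proof. by rewrite /= size_cat size_nseq. Qed.

Lemma block_wordS_val n :
  val (W n.+1) = phi ^+ (s n.+1 + size (W n)) + val (W n).
Proof. by rewrite /= size_cat size_nseq val_nseq0 mul1r. Qed.

Lemma block_word_size n : size (W n) = (size (W n)).-1.+1.
Proof. by case: n. Qed.

Lemma block_word_ge n : phi ^+ (size (W n)).-1 <= val (W n).
Proof.
case: n => [|n]; first by rewrite /= mul1r addr0.
by rewrite block_wordS_size block_wordS_val lerDl val_ge0.
Qed.

Lemma block_wordS_no11 n : no11 (W n.+1) -> no11 (W n).
Proof. by move=> /path_sorted /no11_nseq0. Qed.

(** The value 1 at index -1 makes the recurrence for [r] uniform: it yields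
    the separate formula for [r_1] from the general one. *)
Definition r_prev n : int := if n is n'.+1 then r s n' else 1.

Lemma r_step n : r s n.+1 =
  ((s n.+1)./2.+1)%:Z * r s n + (odd (s n.+1))%:Z * (r s n - r_prev n).
Proof.
case: n => [|n].
  by rewrite [LHS]/= uphalf_half; case: odd => /=; lia.
have -> : r s n.+2 = if odd (s n.+2)
    then ((uphalf (s n.+2))%:Z + 1) * r s n.+1 - r s n
    else ((s n.+2)./2%:Z + 1) * r s n.+1 by [].
by rewrite -[r_prev _]/(r s n) uphalf_half; case: odd; lia.
Qed.

(** [c0] lists the words that start with 0, with this digit removed; its
    count is needed to prepend an odd number of zeros.  It is the total minus
    the number of words that start with 1, which are the words for the next
    shorter block. *)
Lemma reps_block_word n : no11 (W n) ->
  let c := reps (size (W n)) (val (W n)) in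
  let c0 := reps (size (W n)).-1 (val (W n)) in
  [/\ (size c)%:Z = r s n, (size c0)%:Z = r s n - r_prev n
    & all (last false) c].
Proof.
elim: n => [_|n ih hW].
  rewrite /= mul1r addr0 subrr eqxx (negbTE (oner_neq0 _)).
  by split.
have hW' := block_wordS_no11 hW; have [ih1 ih2 ih3] := ih hW'.
have ge := block_word_ge n; have lt := val_lt hW'.
rewrite block_word_size in ih1 ih3 lt.
have eS : reps (size (W n.+1)) (val (W n.+1)) =
    block_reps (size (W n)).-1 (val (W n)) (s n.+1).
  by rewrite block_wordS_size block_wordS_val /block_reps -block_word_size.
have h1 : (size (reps (size (W n.+1)) (val (W n.+1))))%:Z = r s n.+1.
  by rewrite eS size_block // PoszD !PoszM ih1 ih2 r_step.
split=> //; last by rewrite eS last_block.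
move: h1; rewrite block_wordS_size block_wordS_val repsS => <-.
rewrite [_ + val _]addrC addrK reps_lead0 ?val_lt //.
rewrite size_cat !size_map PoszD block_word_size ih1; ring.
Qed.

End BlockWord.

(** * Digit sequences and words *)

Fixpoint window (a : digits) (lo : int) (L : nat) : seq bool :=
  if L is L'.+1 then a (lo + L'%:Z) :: window a lo L' else [::].

Lemma size_window a lo L : size (window a lo L) = L.
Proof. by elim: L => //= L ->. Qed.

Lemma eq_window a b lo L : (forall i, (i < L)%N -> a (lo + i%:Z) = b (lo + i%:Z)) ->
  window a lo L = window b lo L.
Proof.
elim: L => //= L ih h; rewrite h // ih // => i hi; apply: h; exact: ltnW.
Qed.

Lemma nth_rev_window a lo L k :
  nth false (rev (window a lo L)) k = (k < L)%N && a (lo + k%:Z).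
Proof.
elim: L => [|L ih] /=; first by rewrite nth_nil.
rewrite rev_cons nth_rcons size_rev size_window ih ltnS.
by case: ltngtP => // ->.
Qed.

Lemma last_window a lo L : last false (window a lo L.+1) = a lo.
Proof. by elim: L => [|L ih] /=; rewrite ?addr0. Qed.

Lemma digit_window a lo L : digit_word a (lo + L%:Z) lo = window a lo L.+1.
Proof.
rewrite /digit_word [lo + _]addrC addrK absz_nat.
elim: L => [|L ih]; first by rewrite /= subr0 addrC.
rewrite -[iota 0 L.+2]/(0%N :: iota (1 + 0) L.+1) iotaDl map_cons -map_comp.
rewrite subr0 [_ + lo]addrC -[RHS]/(_ :: window a lo L.+1) -ih.
by congr (_ :: _); apply: eq_map => i /=; congr (a _); lia.
Qed.

Definition of_word (lo : int) (w : seq bool) : digits :=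
  fun i => (lo <= i) && nth false (rev w) `|i - lo|.

Definition supp_in (a : digits) (lo : int) (L : nat) :=
  forall i, a i -> lo <= i < lo + L%:Z.

Lemma of_wordK lo w : window (of_word lo w) lo (size w) = w.
Proof.
have ofE v i : of_word lo v (lo + i%:Z) = nth false (rev v) i.
  by rewrite /of_word lerDl /= [lo + _]addrC addrK.
elim: w => //= b w ih; rewrite -[in RHS]ih ofE rev_cons nth_rcons size_rev.
rewrite ltnn eqxx; congr (_ :: _); apply: eq_window => i hi.
by rewrite !ofE rev_cons nth_rcons size_rev hi.
Qed.

Lemma of_word_supp lo w : supp_in (of_word lo w) lo (size w).
Proof.
move=> i /andP [hi hn]; rewrite hi /=; case: (ltnP `|i - lo| (size w)); first by lia.
by move=> h; move: hn; rewrite nth_default ?size_rev.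
Qed.

Lemma windowK a lo L : supp_in a lo L -> of_word lo (window a lo L) = a.
Proof.
move=> ha; apply/funext => i; rewrite /of_word nth_rev_window.
have e : lo <= i -> lo + `|i - lo|%N%:Z = i by lia.
case: (boolP (a i)) => [hi|/negbTE hi].
  by have /andP[h1 h2] := ha i hi; rewrite e // hi h1 andbT; lia.
by case: leP => //= h; rewrite e // hi andbF.
Qed.

Lemma of_word_lowest lo w : of_word lo w lo = last false w.
Proof.
rewrite /of_word lexx subrr /=; case/lastP: w => // w b.
by rewrite rev_rcons last_rcons.
Qed.

Lemma of_word_lead0 lo k w : of_word lo (nseq k false ++ w) = of_word lo w.
Proof.
apply/funext => i; rewrite /of_word rev_cat nth_cat size_rev; congr andb.
case: ltnP => // h; rewrite [RHS]nth_default ?size_rev //.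
by rewrite rev_nseq nth_nseq if_same.
Qed.

Lemma finite_supp (a : digits) : finite_set [set i | a i]%classic ->
  exists lo L, supp_in a lo L.
Proof.
case/finite_seqP => s hs; pose m := \max_(i <- s) `|i|%N.
exists (- m%:Z), (m + m).+1 => i ai.
have si : i \in s by have : [set i | a i]%classic i by []; rewrite hs.
by have : (`|i| <= m)%N by [exact: leq_bigmax_seq]; lia.
Qed.

Lemma supp_finite (a : digits) lo L : supp_in a lo L -> finite_set [set i | a i]%classic.
Proof.
move=> h; apply: sub_finite_set (finite_seq [seq lo + i%:Z | i <- iota 0 L]).
move=> i /h hi; apply/mapP; exists `|i - lo|%N; last by lia.
by rewrite mem_iota; lia.
Qed.

Lemma val_window a lo L :
  val (window a lo L) = \sum_(i < L) (a (lo + i%:Z))%:R * phi ^+ i.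
Proof.
elim: L => [|L ih] /=; first by rewrite big_ord0.
by rewrite big_ord_recr /= ih size_window addrC.
Qed.

Lemma sum_window a lo L : supp_in a lo L ->
  \sum_(i \in [set: int]) (a i)%:R * phi ^ i = phi ^ lo * val (window a lo L).
Proof.
move=> h; rewrite (@fsbigE _ _ _ _ _ [seq lo + i%:Z | i <- iota 0 L]) //; first last.
- move=> i _ hi; case: (boolP (a i)) => [ai|]; last by rewrite mul0r.
  case/negP: hi; apply/mapP; exists `|i - lo|%N; have := h i ai; last by lia.
  by rewrite mem_iota; lia.
- by rewrite map_inj_uniq ?iota_uniq // => i j /addrI [].
rewrite big_mkcond big_map -{1}[L]subn0 -/(index_iota 0 L) big_mkord.
rewrite val_window mulr_sumr; apply: eq_bigr => i _.
rewrite in_setT expfzDr; last by apply: lt0r_neq0; exact: phi_gt0.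
by rewrite mulrCA -exprnP.
Qed.

(** The two-sided sum over all integers becomes the value of a word once the
    support is confined to a window. *)
Lemma expansion_window N a lo L : supp_in a lo L ->
  base_phi_expansion R N a <-> phi ^ lo * val (window a lo L) = N%:R.
Proof.
move=> h; rewrite /base_phi_expansion (sum_window h).
by split => [[_ ->] // | ->]; split => //; exact: supp_finite h.
Qed.

Lemma bergman_no11 N d lo L : bergman_expansion R N d -> no11 (window d lo L).
Proof.
case=> _ h; case: L => //; elim=> //= L ih; rewrite ih andbT.
by rewrite -[L.+1]addn1 PoszD addrA h.
Qed.

(** The two expansions are compared as words on a common window. *)
Lemma bergman_unique N d d' :
  bergman_expansion R N d -> bergman_expansion R N d' -> d = d'.
Proof.
move=> hd hd'; have [[fd _] _] := hd; have [[fd' _] _] := hd'.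
have [lo [L h]] : exists lo L, supp_in (fun i => d i || d' i) lo L.
  apply: finite_supp; rewrite (_ : mkset _ = [set i | d i] `|` [set i | d' i])%classic.
    by rewrite finite_setU.
  by apply/seteqP; split=> i /orP.
have sd : supp_in d lo L by move=> i di; apply: h; rewrite di.
have sd' : supp_in d' lo L by move=> i di; apply: h; rewrite di orbT.
rewrite -(windowK sd) -(windowK sd'); congr of_word; apply: no11_val_inj.
- by rewrite !size_window.
- exact: bergman_no11 hd.
- exact: bergman_no11 hd'.
have [/(expansion_window N sd) e _] := hd.
have [/(expansion_window N sd') e' _] := hd'.
by apply: (mulfI (phiz_neq0 lo)); rewrite e e'.
Qed.

(** * Natural expansions *)

Lemma val_window3 a lo L : val (window a lo L.+3) =
  (a lo)%:R + (a (lo + 1))%:R * phi + (a (lo + 2))%:R * (phi * phi)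
    + \sum_(i < L) (a (lo + i.+3%:Z))%:R * phi ^+ i.+3.
Proof.
by rewrite val_window !big_ord_recl /= addr0 expr0 mulr1 -[RHS]addrA -[RHS]addrA.
Qed.

(** Replacing a final 011 by 100 keeps the value, as [phi * phi = phi + 1],
    but produces a word that ends in 0.  The sequence [b] is the result of this
    replacement. *)
Lemma no_trailing011 a lo L x :
  all (last false) (reps L.+3 x) -> val (window a lo L.+3) = x ->
  [:: a (lo + 2); a (lo + 1); a lo] <> [:: false; true; true].
Proof.
move=> /allP hl hx [a2 a1 a0].
pose b : digits := fun i => if i == lo + 2 then true else
  if (i == lo) || (i == lo + 1) then false else a i.
have b0 : b lo = false by rewrite /b eqxx; case: eqP => //; lia.
have b1 : b (lo + 1) = false by rewrite /b eqxx orbT; case: eqP => //; lia.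
have b2 : b (lo + 2) by rewrite /b eqxx.
suff /hl : window b lo L.+3 \in reps L.+3 x by rewrite last_window b0.
rewrite mem_reps size_window eqxx -hx !val_window3 a0 a1 a2 b0 b1 b2.
rewrite !mul0r !mul1r !add0r addr0 phi_sqr [1 + phi]addrC; apply/eqP.
congr (_ + _); apply: eq_bigr => i _; rewrite /b !ifF //; lia.
Qed.

Lemma lowest_one_uniq a m m' : lowest_one a m -> lowest_one a m' -> m = m'.
Proof.
move=> [am hm] [am' hm']; case: (ltgtP m m') => //.
  by move=> /hm'; rewrite am.
by move=> /hm; rewrite am'.
Qed.

Section NaturalExpansions.
Context (N : nat) (d : digits) (lo : int) (L : nat).
Hypothesis d_bergman : bergman_expansion R N d.
Hypothesis d_lo : lowest_one d lo.
Hypothesis d_supp : supp_in d lo L.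
Local Notation x := (val (window d lo L)).
Hypothesis reps_last : all (last false) (reps L x).

Let x_lt : x < phi ^+ L.
Proof. by have := val_lt (bergman_no11 lo L d_bergman); rewrite size_window. Qed.

Let all_reps k : all (last false) (reps (k + L) x).
Proof. by rewrite reps_lead0 // all_last_prefix. Qed.

Let x_N : phi ^ lo * x = N%:R.
Proof. by apply/(expansion_window N d_supp); case: d_bergman. Qed.

Lemma natural_reps a : natural_expansion R N a <->
  exists2 w, w \in reps L x & a = of_word lo w.
Proof.
split.
  move=> [[ha _] [d' [m [hd' lo' la]]]].
  have e := bergman_unique hd' d_bergman.
  rewrite e in lo'; rewrite (lowest_one_uniq lo' d_lo) in la.
  have [lo1 [L1 s1]] := finite_supp ha.1.
  (* Enough leading places to contain the whole support of [a]. *)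
  pose k := (absz (lo1 - lo) + L1)%N.
  have sa : supp_in a lo (k + L).
    move=> i ai; have := s1 i ai; have : lo <= i.
      by rewrite leNgt; apply/negP => /la.2; rewrite ai.
    by rewrite /k; lia.
  have : window a lo (k + L) \in reps (k + L) x.
    rewrite mem_reps size_window eqxx; apply/eqP.
    by apply: (mulfI (phiz_neq0 lo)); rewrite x_N; apply/(expansion_window N sa).
  rewrite reps_lead0 // => /mapP [w wr hw]; exists w => //.
  by rewrite -(of_word_lead0 lo k) -hw windowK.
move=> [w wr ->]; have := wr; rewrite mem_reps => /andP [/eqP sw /eqP vw].
have sa : supp_in (of_word lo w) lo L by rewrite -sw; exact: of_word_supp.
have la : lowest_one (of_word lo w) lo.
  split; first by rewrite of_word_lowest (allP reps_last).
  by move=> i hi; rewrite /of_word leNgt hi.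
have ha : base_phi_expansion R N (of_word lo w).
  by apply/(expansion_window N sa); rewrite -[in window _ _ _]sw of_wordK vw.
split; last by exists d, lo.
split=> // m /lowest_one_uniq /(_ la) ->.
(* Three more leading places give room for the replacement when [L < 3]. *)
apply: (no_trailing011 (all_reps 3)).
apply: (mulfI (phiz_neq0 lo)); rewrite x_N; apply/expansion_window => //.
by move=> i /sa; lia.
Qed.

Lemma Tot_nu_reps : Tot_nu R N = size (reps L x).
Proof.
have -> : Tot_nu R N = #|` [fset a in map (of_word lo) (reps L x)]%fset|.
  rewrite /Tot_nu; congr (#|` _|); rewrite -[RHS]set_fsetK; congr fset_set.
  apply/seteqP; split => a /=; rewrite !inE.
    by case/natural_reps => w wr ->; apply: map_f.
  by case/mapP => w wr ->; apply/natural_reps; exists w.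
rewrite card_fseq undup_id ?size_map // map_inj_in_uniq ?reps_uniq //.
move=> w w'; rewrite !mem_reps => /andP [/eqP sw _] /andP [/eqP sw' _] e.
by rewrite -(of_wordK lo w) -(of_wordK lo w') e sw sw'.
Qed.

End NaturalExpansions.

End GoldenMean.

Unset Implicit Arguments.

Theorem theorem4p1 (R : realType) (N n : nat) (s : nat -> nat)
    (d : digits) (hi lo : int) :
  bergman_expansion R N d ->
  highest_one d hi ->
  lowest_one d lo ->
  digit_word d hi lo = block_word s n ->
  (Tot_nu R N)%:Z = r s n.
Proof.
move=> hd [d_hi above] [d_lo below] hw.
have lo_hi : lo <= hi by rewrite leNgt; apply/negP => /below; rewrite d_hi.
have hiE : hi = lo + `|hi - lo|%N%:Z by lia.
rewrite hiE digit_window in hw; set L := _.+1 in hw.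
have supp : supp_in d lo L.
  move=> i di; have : lo <= i by rewrite leNgt; apply/negP => /below; rewrite di.
  have : i <= hi by rewrite leNgt; apply/negP => /above; rewrite di.
  by rewrite /L; lia.
have sz : size (block_word s n) = L by rewrite -hw size_window.
have n11 := bergman_no11 lo L hd; rewrite hw in n11.
have [cnt _ ends] := @reps_block_word R s n n11.
rewrite sz -hw in cnt ends.
by rewrite (Tot_nu_reps hd (conj d_lo below) supp ends).
Qed.
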